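(* Let $f,g$ be probability densities on $\mathbb{R}_+=[0,\infty)$. (i) Let $f,g\in\mathcal{L}$. Then $f*g\in\mathcal{S}$ if and only if $pf+(1-p)g\in\mathcal{S}$ for some $p\in(0,1)$. Moreover, if $f*g\in\mathcal{S}$, then $f*g(x)\sim f(x)+g(x)$ as $x\to\infty$. (ii) Let $f,g\in\mathcal{S}$. Then $f*g\in\mathcal{S}$ if and only if $f*g(x)\sim f(x)+g(x)$ as $x\to\infty$.
   Context: For non-negative functions, $\alpha(x)\sim\beta(x)$ means $\lim_{x\to\infty}\alpha(x)/\beta(x)=1$. For probability densities $f,g$ on $\mathbb{R}$, $f*g(x)=\int_{-\infty}^{\infty}f(x-y)g(y)\,dy$ and $f^{*2}=f*f$. A density on $\mathbb{R}_+$ is regarded as a density on $\mathbb{R}$ vanishing on $(-\infty,0)$. A non-negative measurable function $f$ on $\mathbb{R}$ is long-tailed, $f\in\mathcal{L}$, if $\lim_{x\to\infty}f(x-y)/f(x)=1$ for every $y\in\mathbb{R}$. A probability density $f$ is subexponential, $f\in\mathcal{S}$, if $f\in\mathcal{L}$ and $f^{*2}(x)\sim 2f(x)$ as $x\to\infty$. *)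

(* Defs.v *)
From HB Require Import structures.
From mathcomp Require Import all_boot all_order all_algebra.
From mathcomp Require Import all_classical all_reals all_analysis.
From mathcomp Require Import measurable_realfun.
Set Implicit Arguments.
Unset Strict Implicit.
Unset Printing Implicit Defensive.
Import Order.TTheory GRing.Theory Num.Theory.
Import numFieldNormedType.Exports.
Local Open Scope classical_set_scope.
Local Open Scope ring_scope.
Local Open Scope ereal_scope.

(* Functions take values in \bar R because the convolution of two finite
   densities may be +oo on a null set.

   Division on \bar R is total, with 0^-1 = +oo, +oo^-1 = 0 and 0 * +oo = 0, so
   0 / 0 = 0, a / 0 = +oo for a > 0, and a / +oo = 0 for a >= 0.  Hence, for
   non-negative functions, a ratio tending to 1 forces numerator and denominator
   to be finite and positive from some point on. *)

Definition asymp_equiv (R : realType) (a b : R -> \bar R) : Prop :=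
  a x / b x @[x --> +oo%R] --> 1.

Definition prob_density (R : realType) (f : R -> \bar R) : Prop :=
  [/\ measurable_fun [set: R] f, (forall x, 0 <= f x)
    & \int[lebesgue_measure]_x f x = 1].

Definition convolution (R : realType) (f g : R -> \bar R) (x : R) : \bar R :=
  \int[lebesgue_measure]_y (f (x - y)%R * g y).

Definition long_tailed (R : realType) (f : R -> \bar R) : Prop :=
  [/\ measurable_fun [set: R] f, (forall x, 0 <= f x)
    & forall y : R, f (x - y)%R / f x @[x --> +oo%R] --> 1].

Definition subexponential (R : realType) (f : R -> \bar R) : Prop :=
  [/\ prob_density f, long_tailed f
    & asymp_equiv (convolution f f) (fun x => 2%:E * f x)].

Definition density_on_Rplus (R : realType) (f : R -> R) : Prop :=
  prob_density (EFin \o f) /\ (forall x : R, (x < 0)%R -> f x = 0%R).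

(* Main.v *)
Require Import Defs.
From HB Require Import structures.
From mathcomp Require Import all_boot all_order all_algebra.
From mathcomp Require Import all_classical all_reals all_analysis.
From mathcomp Require Import measurable_realfun.
From mathcomp Require Import ring lra.
Set Implicit Arguments.
Unset Strict Implicit.
Unset Printing Implicit Defensive.
Import Order.TTheory GRing.Theory Num.Theory.
Import numFieldNormedType.Exports.
Local Open Scope ring_scope.

(** Fix A > 0.  For x > 2A the convolution of two densities on the half-line
    splits as
      (f * g)(x) = head(f, g) + mid(f, g) + head(g, f),
    where head(f, g) integrates f(x - y) g(y) over [0, A] and mid(f, g)
    integrates it over ]A, x - A[; the remaining part [x - A, x] becomes
    head(g, f) after the reflection y -> x - y (convolution_split).

    A long-tailed measurable f satisfies f(x - y) ~ f(x) uniformly in y in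
    [0, A] (long_tailed_uniform), so head(f, g) is f(x) times the mass of g on
    [0, A], which is close to f(x) for large A (conv_head_bounds).  Hence f * g
    is always at least about f + g (convolution_ge), and only the middle part
    is in question.  If w is subexponential, then w * w ~ 2w while its two heads
    already account for almost 2w, so mid(w, w) is at most e w for large A
    (subexponential_conv_mid).  The middle part only sees large arguments, so it
    is monotone under tail domination: if f, g = O(w), then
    mid(f, g) = O(mid(w, w)).  Therefore f * g <= (1 + e)(f + g) + e w
    (convolution_le), and this single estimate carries everything else.

    - With f = g it says that a long-tailed density of the same order as a
      subexponential one is subexponential (subexponential_tail_equiv).
    - With w = f * g subexponential, f and g are O(w) by the lower bound, and
      the term e w is absorbed on the left: f * g ~ f + g.  The half mixture
      m = (f + g) / 2 then has the order of w and inherits subexponentiality.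
    - With w = p f + (1 - p) g subexponential, f and g are O(w) and w = O(f + g),
      so f * g ~ f + g; thus f * g is long-tailed of the order of w, hence
      subexponential.
    - If f and g are subexponential and f * g ~ f + g, expanding the square of
      m gives m * m = (f * f + 2 f * g + g * g) / 4 ~ f + g = 2m,
      which reduces the claim to the previous case. *)

(** * Asymptotic equivalence as two-sided bounds *)

Section asymptotics.
Local Open Scope classical_set_scope.
Local Open Scope ereal_scope.
Context {R : realType}.
Implicit Types a b : R -> \bar R.

(** The conventions for division by 0 and by +oo make every degenerate quotient
    0 or +oo, so a finite positive quotient forces both terms to be finite and
    positive. *)
Lemma ediv_pos_finP (u v : \bar R) (r : R) : 0 <= u -> 0 <= v -> (0 < r)%R ->
  u / v = r%:E -> exists2 c : R, (0 < c)%R & v = c%:E /\ u = (r * c)%:E.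
Proof.
move=> u0 + r0; case: v => [c| |]; last 2 first.
- by move=> _; rewrite invey mule0 => -[r0']; rewrite -r0' ltxx in r0.
- by rewrite leeNy_eq.
rewrite lee_fin le_eqVlt => /predU1P[<-|c0].
  rewrite inve0; move: u0; rewrite le_eqVlt => /predU1P[<-|u0].
    by rewrite mul0e => -[r0']; rewrite -r0' ltxx in r0.
  by rewrite gt0_muley.
rewrite inver gt_eqF// => uc; exists c => //; split=> //.
by rewrite EFinM -uc -muleA -EFinM mulVf ?gt_eqF// mule1.
Qed.

(** Two-sided multiplicative bounds survive integration and sums of extended
    reals, which quotients do not; all later estimates use this form. *)
Lemma asymp_equivP a b : (forall x, 0 <= a x) -> (forall x, 0 <= b x) ->
  asymp_equiv a b <->
  (\forall x \near +oo%R, 0 < b x < +oo) /\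
  (forall e : R, (0 < e)%R -> \forall x \near +oo%R,
     (1 - e)%:E * b x <= a x <= (1 + e)%:E * b x).
Proof.
move=> a0 b0; rewrite /asymp_equiv; split.
  move=> /fine_cvgP[abfin] /cvgrPdist_lt ab1.
  have pw (e : R) : (0 < e < 1)%R -> \forall x \near +oo%R,
      exists r c : R, [/\ (0 < c)%R, b x = c%:E, a x = (r * c)%:E &
        (1 - e < r < 1 + e)%R].
    move=> /andP[e0 e1]; near=> x.
    have xfin : a x / b x \is a fin_num by near: x.
    have : (`|1 - fine (a x / b x)| < e)%R by near: x; exact: ab1.
    rewrite ltr_distlC => /andP[l u].
    have r0 : (0 < fine (a x / b x))%R by lra.
    have [c c0 [bE aE]] := ediv_pos_finP (a0 x) (b0 x) r0 (esym (fineK xfin)).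
    by exists (fine (a x / b x)), c; rewrite -aE -bE; split=> //; apply/andP; split; lra.
  split.
    have h : (0 < (2^-1 : R) < 1)%R by apply/andP; split; lra.
    near=> x; have [r [c [c0 -> _ _]]] : exists r c : R,
      [/\ (0 < c)%R, b x = c%:E, a x = (r * c)%:E & (1 - 2^-1 < r < 1 + 2^-1)%R].
      by near: x; exact: pw.
    by rewrite lte_fin c0 ltry.
  move=> e e0.
  have h : (0 < Num.min e 2^-1 < 1)%R.
    by rewrite lt_min e0 gt_min; apply/andP; split; lra.
  near=> x; have [r [c [c0 -> -> /andP[rl ru]]]] : exists r c : R,
    [/\ (0 < c)%R, b x = c%:E, a x = (r * c)%:E
      & (1 - Num.min e 2^-1 < r < 1 + Num.min e 2^-1)%R].
    by near: x; exact: pw.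
  have me : (Num.min e 2^-1 <= e)%R by rewrite ge_min lexx.
  rewrite -!EFinM !lee_fin !ler_pM2r//; apply/andP; split; lra.
move=> [bfin ab].
have pw (e : R) : (0 < e)%R -> \forall x \near +oo%R,
    exists2 r : R, a x / b x = r%:E & (`|1 - r| <= e)%R.
  move=> e0; near=> x.
  have /andP[b0' by'] : 0 < b x < +oo by near: x.
  have : (1 - e)%:E * b x <= a x <= (1 + e)%:E * b x by near: x; exact: ab.
  have bf : b x \is a fin_num by rewrite ge0_fin_numE// ltW.
  move: b0' (a0 x); rewrite -(fineK bf); set c := fine (b x) => c0.
  rewrite lte_fin in c0.
  case: (a x) => [s| |]; last 2 first.
  - by move=> _; rewrite -!EFinM leye_eq andbF.
  - by rewrite leeNy_eq.
  move=> _; rewrite -!EFinM !lee_fin => /andP[l u].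
  exists (s / c)%R; first by rewrite inver gt_eqF.
  rewrite ler_distlC ler_pdivlMr// ler_pdivrMr//; apply/andP; split; lra.
apply/fine_cvgP; split.
  near=> x; have [r -> _] : exists2 r : R, a x / b x = r%:E & (`|1 - r| <= 1)%R.
    by near: x; exact: pw.
  by [].
apply/cvgrPdist_le => e e0; near=> x => /=.
have [r -> //] : exists2 r : R, a x / b x = r%:E & (`|1 - r| <= e)%R.
by near: x; exact: pw.
Unshelve. all: by end_near. Qed.

End asymptotics.

(** * Reflections and translations of the line *)

Section reflections.
Local Open Scope classical_set_scope.
Local Open Scope ereal_scope.
Context {R : realType}.

Lemma lebesgue_measure_reflect (c : R) (A : set R) : measurable A ->
  pushforward (@lebesgue_measure R) (fun x : R => (c - x)%R : measurableTypeR R) A =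
  lebesgue_measure A.
Proof.
have mphi : measurable_fun [set: R] (fun x : R => (c - x)%R).
  by apply: measurable_funB.
move=> mA.
pose mphi' := isMeasurableFun.Build _ _ (measurableTypeR R) (measurableTypeR R) _ mphi.
pose phi : {mfun measurableTypeR R >-> measurableTypeR R} :=
  HB.pack (fun x : R => (c - x)%R) mphi'.
apply/esym.
apply: (@lebesgue_measure_unique R (pushforward lebesgue_measure phi)) => //= _ [[a b]] _ <-.
rewrite /pushforward/= (_ : phi @^-1` _ = `[(c - b)%R, (c - a)%R[%classic).
  rewrite !lebesgue_measure_itv/= !lte_fin.
  rewrite ltrD2l ltrN2; case: ifPn => // _.
  by rewrite -!EFinB; congr EFin; ring.
apply/seteqP; split => x; rewrite /= !in_itv/= => /andP[? ?]; apply/andP; split; lra.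
Qed.

(** The substitution y -> c - y gives the symmetry of convolution and, applied
    twice, the translation invariance of the integral. *)
Lemma ge0_integral_reflect (c : R) (D : set R) (f : R -> \bar R) :
  measurable D -> measurable_fun [set: R] f -> (forall x, 0 <= f x) ->
  \int[lebesgue_measure]_(x in D) f x =
  \int[lebesgue_measure]_(x in [set x | D (c - x)%R]) f (c - x)%R.
Proof.
move=> mD mf f0.
have mphi : measurable_fun [set: R] (fun x : R => (c - x)%R : measurableTypeR R).
  by apply: measurable_funB.
rewrite -[RHS](@ge0_integral_pushforward _ _ (measurableTypeR R) (measurableTypeR R)
  R _ mphi lebesgue_measure D f)//; last first.
  exact: measurable_funS mf.
by apply: eq_measure_integral => A mA AD; exact/esym/lebesgue_measure_reflect.
Qed.

Lemma measurable_fun_reflect (c : R) (f : R -> \bar R) : measurable_fun [set: R] f ->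
  measurable_fun [set: R] (fun y => f (c - y)%R).
Proof.
by move=> mf; apply: (measurableT_comp mf); exact: measurable_funB.
Qed.

Lemma lebesgue_measure_translate (c : R) (A : set R) : measurable A ->
  measurable [set x : R | A (x - c)%R] /\
  lebesgue_measure [set x : R | A (x - c)%R] = lebesgue_measure A.
Proof.
move=> mA.
have mN (d : R) (B : set R) : measurable B -> measurable [set x : R | B (d - x)%R].
  move=> mB; rewrite -[X in measurable X]setTI.
  suff mphi : measurable_fun [set: R] (fun x : R => (d - x)%R) by exact: mphi.
  by apply: measurable_funB.
(* A translation is the composite of two reflections. *)
have -> : [set x : R | A (x - c)%R] =
    [set x : R | [set y : R | A (- c - y)%R] (0 - x)%R].
  by apply/seteqP; split=> x /=; rewrite sub0r opprK addrC.
split; first exact: mN (mN _ _ mA).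
have h1 := @lebesgue_measure_reflect 0%R _ (mN (- c)%R _ mA).
have h2 := @lebesgue_measure_reflect (- c)%R _ mA.
by rewrite -[RHS]h2; exact: h1.
Qed.

End reflections.

(** * Uniform convergence for long-tailed functions *)

Section uniform_convergence.
Local Open Scope classical_set_scope.
Local Open Scope ereal_scope.
Context {R : realType}.
Implicit Types f : R -> \bar R.

Lemma long_tailedP f : long_tailed f ->
  (\forall x \near +oo%R, 0 < f x < +oo) /\
  (forall y e : R, (0 < e)%R -> \forall x \near +oo%R,
     (1 - e)%:E * f x <= f (x - y)%R <= (1 + e)%:E * f x).
Proof.
move=> [_ f0 lf].
have {}lf y := (asymp_equivP (fun x => f0 (x - y)%R) f0).1 (lf y).
by split=> [|y]; [exact: (lf 0%R).1|exact: (lf y).2].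
Qed.

Definition good_shifts f (c : nat -> R) (L d : R) (n : nat) : set R :=
  `[0%R, L] `&` [set y | forall m, (n <= m)%N ->
     (1 - d)%:E * f (c m) <= f (c m - y)%R <= (1 + d)%:E * f (c m)].

(** Every fixed shift is eventually good, so the good shifts exhaust [0, L] and
    their measure tends to L by continuity from below.  This is where the
    measurability of f enters. *)
Lemma long_tailed_good_shifts f (c : nat -> R) (L d : R) : long_tailed f ->
    c n @[n --> \oo] --> +oo%R -> (0 < L)%R -> (0 < d)%R ->
  let E := good_shifts f c L d in
  (forall n, measurable (E n)) /\ lebesgue_measure (E n) @[n --> \oo] --> L%:E.
Proof.
move=> lf cy L0 d0 E; have [mf f0 _] := lf.
have [_ fs] := long_tailedP lf.
have mE n : measurable (E n).
  apply: measurableI => //.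
  pose G m := [set: R] `&` [set y | (1 - d)%:E * f (c m) <= f (c m - y)%R] `&`
    ([set: R] `&` [set y | f (c m - y)%R <= (1 + d)%:E * f (c m)]).
  rewrite (_ : [set y | _] =
      \bigcap_(m in [set m | (n <= m)%N]) G m).
    apply: bigcap_measurableType => m _; apply: measurableI.
      exact: emeasurable_fun_c_infty (measurable_fun_reflect _ mf) _.
    exact: emeasurable_fun_infty_c (measurable_fun_reflect _ mf) _.
  apply/seteqP; split => y /= yP m /yP; first by move=> /andP[].
  by move=> [[_ ? [_ ?]]]; apply/andP.
split=> //.
have UE : \bigcup_n E n = `[0%R, L].
  apply/seteqP; split=> [y [n _ []]//|y yL].
  have /cy[N _ NP] := fs y d d0.
  by exists N => //; split=> // m; exact: NP.
have : lebesgue_measure (\bigcup_n E n) = L%:E :> \bar R.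
  by rewrite UE lebesgue_measure_itv/= lte_fin L0 sube0.
move=> <-; apply: nondecreasing_cvg_mu => //; first by rewrite UE.
move=> n m nm; apply/subsetPset => y [? yP]; split=> // k mk.
by apply: yP; exact: leq_trans mk.
Qed.

(** If uniformity fails, there are points c_n -> +oo and shifts s_n in [0, A] such
    that f(c_n - s_n) is not within the factor 1 +- e of f(c_n).  For large n
    almost all of [0, 2A] consists of good shifts y for c_n, and almost all of
    [0, A] of good shifts z for c_n - s_n.  Both y and s_n + z range over
    [0, 2A], so for measure reasons some point is of both kinds; comparing
    f(c_n - y) with f(c_n) and with f(c_n - s_n) yields a contradiction. *)
Lemma long_tailed_uniform f (A e : R) : long_tailed f -> (0 < A)%R -> (0 < e)%R ->
  \forall x \near +oo%R, forall y, (0 <= y <= A)%R ->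
    (1 - e)%:E * f x <= f (x - y)%R <= (1 + e)%:E * f x.
Proof.
move=> lf A0 e0; apply: contrapT => nP.
have [fpos _] := long_tailedP lf.
have /choice[c cP] : forall n : nat, exists xy : R * R,
    [/\ (n%:R < xy.1)%R, (0 <= xy.2 <= A)%R &
     ~ ((1 - e)%:E * f xy.1 <= f (xy.1 - xy.2)%R <= (1 + e)%:E * f xy.1)].
  move=> n; apply: contrapT => nex; apply: nP; exists n%:R; split.
    exact: num_real.
  move=> x nx y yA; apply: contrapT => bad; apply: nex.
  by exists (x, y).
have toy (z : nat -> R) : (forall n, (n%:R - A < z n)%R) ->
    z n @[n --> \oo] --> +oo%R.
  move=> zA; apply/cvgryPgt => M; near=> n.
  apply: lt_trans (zA n); rewrite ltrBrDr; near: n.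
  exact: (cvgryPgt _).1 cvgr_idn _.
have xy : (c n).1 @[n --> \oo] --> +oo%R.
  by apply: toy => n; have [+ _ _] := cP n; lra.
have zy : ((c n).1 - (c n).2)%R @[n --> \oo] --> +oo%R.
  by apply: toy => n; have [+ /andP[_ +] _] := cP n; lra.
(* Small enough that (1 + d) / (1 - d) <= 1 + e and 1 - e <= (1 - d) / (1 + d). *)
pose d := (Num.min e 1 / 4)%R.
have [d0 d1 de] : [/\ (0 < d)%R, (4 * d <= 1)%R & (4 * d <= e)%R].
  have -> : (4 * d = Num.min e 1)%R by rewrite /d; field.
  by rewrite !ge_min !lexx orbT; split=> //; rewrite divr_gt0// lt_min e0 ltr01.
have A2 : (0 < 2 * A)%R by lra.
have [mE1 cE1] := long_tailed_good_shifts lf xy A2 d0.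
have [mE2 cE2] := long_tailed_good_shifts lf zy A0 d0.
move: mE1 cE1 mE2 cE2; set E1 := good_shifts _ _ _ _; set E2 := good_shifts _ _ _ _.
move=> mE1 cE1 mE2 cE2.
have A1 : (3 / 2 * A)%:E < (2 * A)%:E by rewrite lte_fin; lra.
have A3 : (A / 2)%:E < A%:E by rewrite lte_fin; lra.
near \oo => n.
have [E1big E2big fx0 fz0] : [/\ (3 / 2 * A)%:E < lebesgue_measure (E1 n),
    (A / 2)%:E < lebesgue_measure (E2 n), 0 < f (c n).1 < +oo &
    0 < f ((c n).1 - (c n).2)%R < +oo].
  split; near: n.
  - exact: cE1 _ (open_ereal_gt' A1).
  - exact: cE2 _ (open_ereal_gt' A3).
  - exact: xy _ fpos.
  - exact: zy _ fpos.
have [mT muT] := lebesgue_measure_translate (c n).2 (mE2 n).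
have [_ yA cbad] := cP n.
have [y [E1y E2y]] : E1 n `&` [set y | E2 n (y - (c n).2)%R] !=set0.
  apply/set0P/negP => /eqP disj.
  have : lebesgue_measure (E1 n `|` [set y | E2 n (y - (c n).2)%R]) <=
      lebesgue_measure `[0%R, (2 * A)%R] :> \bar R.
    apply: le_measure; rewrite ?inE//.
      by apply: (@measurableU _ (measurableTypeR R)); [exact: mE1|exact: mT].
    move=> y [[]//|[]]; rewrite /= !in_itv/= => /andP[? ?] _.
    by move/andP: yA => [? ?]; apply/andP; split; lra.
  have -> : lebesgue_measure (E1 n `|` [set y | E2 n (y - (c n).2)%R]) =
      lebesgue_measure (E1 n) + lebesgue_measure (E2 n) :> \bar R.
    by rewrite -muT; apply: (measureU lebesgue_measure (mE1 n) mT disj).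
  rewrite lebesgue_measure_itv/= lte_fin mulr_gt0// sube0.
  apply/negP; rewrite -ltNge; apply: le_lt_trans (lteD E1big E2big).
  rewrite -EFinD lee_fin; lra.
have /andP[l1 u1] := E1y.2 n (leqnn n); have /andP[l2 u2] := E2y.2 n (leqnn n).
apply: cbad; move: l1 u1 l2 u2 fx0 fz0.
have -> : ((c n).1 - (c n).2 - (y - (c n).2) = (c n).1 - y)%R by ring.
set a := f _; set b := f (_ - (c n).2)%R; set s := f _.
move=> l1 u1 l2 u2 /andP[a0 ay] /andP[b0 by'].
have afin : a \is a fin_num by rewrite ge0_fin_numE// ltW.
have bfin : b \is a fin_num by rewrite ge0_fin_numE// ltW.
have sfin : s \is a fin_num.
  rewrite fin_numElt (lt_le_trans _ l1) ?(le_lt_trans u1)//.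
    by rewrite -(fineK afin) -EFinM ltry.
  by rewrite -(fineK afin) -EFinM ltNyr.
move: l1 u1 l2 u2 a0 b0; rewrite -(fineK afin) -(fineK bfin) -(fineK sfin).
rewrite -!EFinM !lte_fin !lee_fin.
move: (fine a) (fine b) (fine s) => {afin bfin sfin ay by'}{}a {}b {}s.
move=> l1 u1 l2 u2 a0 b0; apply/andP; split; nra.
Unshelve. all: by end_near. Qed.

End uniform_convergence.

(** * Densities on the half-line and their convolution *)

Section convolution_densities.
Local Open Scope classical_set_scope.
Local Open Scope ereal_scope.
Context {R : realType}.
Implicit Types f g : R -> \bar R.

(** The extended-real form of density_on_Rplus, which the convolution of two
    densities also satisfies. *)
Definition halfline_density f := prob_density f /\ (forall x, (x < 0)%R -> f x = 0).

Lemma prob_density_ge0 f : prob_density f -> forall x, 0 <= f x.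
Proof. by case. Qed.

Lemma measurable_convolution_integrand f g (x : R) (D : set R) :
  measurable_fun [set: R] f -> measurable_fun [set: R] g ->
  measurable_fun D (fun y => f (x - y)%R * g y).
Proof.
move=> mf mg; apply: (@measurable_funS _ _ _ _ setT) => //.
by apply: emeasurable_funM => //; exact: measurable_fun_reflect.
Qed.

Lemma measurable_convolution_kernel f g :
  measurable_fun [set: R] f -> measurable_fun [set: R] g ->
  measurable_fun [set: measurableTypeR R * measurableTypeR R]
    (fun z => f (z.1 - z.2)%R * g z.2).
Proof.
move=> mf mg; apply: emeasurable_funM.
  apply: (measurableT_comp mf).
  by apply: measurable_funB; [exact: measurable_fst|exact: measurable_snd].
by apply: (measurableT_comp mg); exact: measurable_snd.
Qed.

(** By Tonelli, the total mass of f * g is the product of the masses. *)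
Lemma convolution_prob_density f g : prob_density f -> prob_density g ->
  prob_density (convolution f g).
Proof.
move=> [mf f0 f1] [mg g0 g1].
pose F (z : measurableTypeR R * measurableTypeR R) := f (z.1 - z.2)%R * g z.2.
have mF : measurable_fun setT F by exact: measurable_convolution_kernel.
have F0 z : 0 <= F z by rewrite mule_ge0.
split.
- exact: (@measurable_fun_fubini_tonelli_F _ _ (measurableTypeR R) (measurableTypeR R) R lebesgue_measure F mF F0).
- by move=> x; apply: integral_ge0 => y _; exact: (F0 (x, y)).
- rewrite /convolution (@fubini_tonelli _ _ (measurableTypeR R) (measurableTypeR R) R lebesgue_measure lebesgue_measure F)//.
  rewrite -[RHS]g1; apply: eq_integral => y _; rewrite /F/=.
  under eq_integral do rewrite muleC.
  rewrite ge0_integralZl//; last first.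
    by apply: (measurableT_comp mf); exact: measurable_funB.
  rewrite (_ : \int[@lebesgue_measure R]_x f (x - y)%R = 1) ?mule1//.
  rewrite (ge0_integral_reflect 0%R)//; last first.
    by apply: (measurableT_comp mf); exact: measurable_funB.
  rewrite -[RHS]f1 [RHS](ge0_integral_reflect (- y)%R)//.
  by apply: eq_integral => x _; rewrite sub0r addrC.
Qed.

Lemma convolution_halfline f g : halfline_density f -> halfline_density g ->
  halfline_density (convolution f g).
Proof.
move=> [df f0] [dg g0]; split; first exact: convolution_prob_density.
move=> x x0; apply: integral0_eq => y _.
have [y0|y0] := ltP y 0%R; first by rewrite g0// mule0.
by rewrite f0 ?mul0e//; lra.
Qed.

(** The contribution to (f * g)(x) of the y in [0, A], where the argument of f
    stays within A of x. *)
Definition conv_head f g (A x : R) : \bar R :=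
  \int[lebesgue_measure]_(y in `[0%R, A]) (f (x - y)%R * g y).

(** The contribution to (f * g)(x) where both arguments exceed A. *)
Definition conv_mid f g (A x : R) : \bar R :=
  \int[lebesgue_measure]_(y in `]A, (x - A)%R[) (f (x - y)%R * g y).

(** The condition 2A < x makes the three ranges [0, A], ]A, x - A[ and [x - A, x]
    disjoint. *)
Lemma convolution_split f g (A x : R) : halfline_density f -> halfline_density g ->
  (0 < A)%R -> (2 * A < x)%R ->
  convolution f g x = conv_head f g A x + conv_mid f g A x + conv_head g f A x.
Proof.
move=> [[mf f0 _] fN] [[mg g0 _] gN] A0 Ax.
have mh (D : set R) : measurable_fun D (fun y => f (x - y)%R * g y).
  exact: measurable_convolution_integrand.
have h0 y : 0 <= f (x - y)%R * g y by rewrite mule_ge0.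
have -> : conv_head g f A x =
    \int[lebesgue_measure]_(y in `[(x - A)%R, x]) (f (x - y)%R * g y).
  rewrite (ge0_integral_reflect x)//.
  rewrite (_ : [set _ | _] = `[0%R, A]).
    by apply: eq_integral => y _; rewrite muleC subKr.
  apply/seteqP; split => y; rewrite /= !in_itv/= => /andP[? ?];
    apply/andP; split; lra.
have -> : convolution f g x =
    \int[lebesgue_measure]_(y in `[0%R, x]) (f (x - y)%R * g y).
  rewrite /convolution [RHS]integral_mkcond; apply: eq_integral => y _.
  rewrite /patch; case: ifPn => //; rewrite notin_setE/= in_itv/= => yx.
  have [y0|y0] := ltP y 0%R; first by rewrite gN// mule0.
  rewrite fN ?mul0e//; rewrite ltNge; apply/negP => xy.
  by apply: yx; rewrite y0/=; lra.
have -> : `[0%R, x] = `[0%R, A] `|` `]A, (x - A)%R[ `|` `[(x - A)%R, x].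
  apply/seteqP; split=> y; rewrite /= !in_itv/=.
    move=> /andP[y0 yx]; have [yA|yA] := leP y A.
      by left; left; rewrite y0.
    have [yxA|yxA] := leP (x - A)%R y; first by right; rewrite yx.
    by left; right.
  by move=> [[]|] /andP[? ?]; apply/andP; split; lra.
rewrite ge0_integral_setU//.
- rewrite ge0_integral_setU//; first exact: mh.
  rewrite disj_set2E; apply/eqP/seteqP; split => // y [] /=.
  by rewrite !in_itv/= => /andP[? ?] /andP[? ?]; lra.
- exact: (@measurableU _ (measurableTypeR R)).
- exact: mh.
- rewrite disj_set2E; apply/eqP/seteqP; split => // y [] /=.
  by rewrite !in_itv/= => -[] /andP[? ?] /andP[? ?]; lra.
Qed.

Lemma halfline_density_mass f (e : R) : halfline_density f -> (0 < e)%R ->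
  exists2 A0 : R, (0 < A0)%R & forall A, (A0 <= A)%R ->
    (1 - e)%:E <= \int[lebesgue_measure]_(y in `[0%R, A]) f y <= 1.
Proof.
move=> [[mf f0 f1] fN] e0.
have le1 (D : set R) : measurable D -> \int[lebesgue_measure]_(y in D) f y <= 1.
  by move=> mD; rewrite -f1; exact: ge0_subset_integral.
pose F (n : nat) : set R := `[0%R, n%:R].
have ndF : nondecreasing_seq F.
  move=> n m nm; apply/subsetPset => y; rewrite /F/= !in_itv/= => /andP[-> yn]/=.
  by rewrite (le_trans yn)// ler_nat.
have mF n : measurable (F n) by exact: measurable_itv.
have UF : \int[lebesgue_measure]_(y in \bigcup_n F n) f y = 1.
  rewrite -f1 integral_mkcond; apply: eq_integral => y _; rewrite /patch.
  case: ifPn => //; rewrite notin_setE => yF.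
  have [y0|y0] := ltP y 0%R; first by rewrite fN.
  exfalso; apply: yF; exists (Num.truncn y).+1 => //.
  by rewrite /F/= in_itv/= y0/= ltW// truncnS_gt.
have e1 : (1 - e)%:E < 1%:E :> \bar R by rewrite lte_fin; lra.
have cF := @ge0_nondecreasing_set_cvg_integral _ (measurableTypeR R) R F f
  lebesgue_measure ndF mF
  (fun n => measurable_funS measurableT (@subsetT _ _) mf) (fun _ y _ => f0 y).
have : \forall n \near \oo,
    (1 - e)%:E < \int[lebesgue_measure]_(y in F n) f y.
  by move: cF; rewrite UF => /(_ _ (open_ereal_gt' e1)).
move=> [N _ NP].
exists N.+1%:R => [//|A NA]; rewrite le1// andbT.
apply: le_trans (ltW (NP N.+1 _)) _ => /=; first exact: leqnSn.
apply: ge0_subset_integral => //; [exact: mF|exact: measurable_funTS|].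
by move=> y; rewrite /F/= !in_itv/= => /andP[-> yN]; rewrite (le_trans yN).
Qed.

End convolution_densities.

(** * Upper and lower bounds on convolution tails *)

Section tail_estimates.
Local Open Scope classical_set_scope.
Local Open Scope ereal_scope.
Context {R : realType}.
Implicit Types f g w : R -> \bar R.

(** Uniform convergence replaces f(x - y) by f(x) in the integral; what remains is
    the mass of g on [0, A], which is close to 1 for large A. *)
Lemma conv_head_bounds f g (e : R) : long_tailed f -> halfline_density g -> (0 < e)%R ->
  exists2 A0 : R, (0 < A0)%R & forall A, (A0 <= A)%R ->
    \forall x \near +oo%R, (1 - e)%:E * f x <= conv_head f g A x <= (1 + e)%:E * f x.
Proof.
move=> lf dg e0; have [mf f0 _] := lf; have [[mg g0 _] _] := dg.
(* Small enough that (1 - d)^2 >= 1 - e, one factor for f and one for the mass. *)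
pose d := (Num.min e 1 / 2)%R.
have [d0 d1 de] : [/\ (0 < d)%R, (2 * d <= 1)%R & (2 * d <= e)%R].
  have -> : (2 * d = Num.min e 1)%R by rewrite /d; field.
  by rewrite !ge_min !lexx orbT; split=> //; rewrite divr_gt0// lt_min e0 ltr01.
have [A0 A00 mass] := halfline_density_mass dg d0.
exists A0 => // A A0A; have /andP[m1 m2] := mass A A0A.
have A_gt0 : (0 < A)%R by exact: lt_le_trans A0A.
have unif := long_tailed_uniform lf A_gt0 d0.
near=> x.
have fx : forall y, (0 <= y <= A)%R ->
    (1 - d)%:E * f x <= f (x - y)%R <= (1 + d)%:E * f x by near: x.
have mI : measurable_fun `[0%R, A] (fun y => f (x - y)%R * g y).
  exact: measurable_convolution_integrand.
have mgA : measurable_fun (`[0%R, A] : set R) g by exact: measurable_funTS.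
have l0 : 0 <= (1 - d)%:E * f x by rewrite mule_ge0// lee_fin; lra.
have u0 : 0 <= (1 + d)%:E * f x by rewrite mule_ge0// lee_fin; lra.
apply/andP; split.
  apply: (@le_trans _ _ (\int[lebesgue_measure]_(y in `[0%R, A]) ((1 - d)%:E * f x * g y))).
    rewrite ge0_integralZl//.
    apply: (@le_trans _ _ ((1 - d)%:E * f x * (1 - d)%:E)); last exact: lee_wpmul2l.
    rewrite muleAC -EFinM lee_wpmul2r// lee_fin; nra.
  apply: ge0_le_integral => //.
  - by move=> y _; rewrite mule_ge0.
  - exact: measurable_funeM.
  - move=> y; rewrite /= in_itv/= => /fx/andP[fy _]; exact: lee_wpmul2r.
apply: (@le_trans _ _ (\int[lebesgue_measure]_(y in `[0%R, A]) ((1 + d)%:E * f x * g y))).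
  apply: ge0_le_integral => //.
  - by move=> y _; rewrite mule_ge0.
  - exact: measurable_funeM.
  - move=> y; rewrite /= in_itv/= => /fx/andP[_ fy]; exact: lee_wpmul2r.
rewrite ge0_integralZl//.
apply: (@le_trans _ _ ((1 + d)%:E * f x * 1)); first exact: lee_wpmul2l.
by rewrite mule1 lee_wpmul2r// lee_fin; lra.
Unshelve. all: by end_near. Qed.

Lemma conv_mid_ge0 f g (A x : R) : halfline_density f -> halfline_density g ->
  0 <= conv_mid f g A x.
Proof.
by move=> [[_ f0 _] _] [[_ g0 _] _]; apply: integral_ge0 => y _; rewrite mule_ge0.
Qed.

(** Both arguments y and x - y exceed A >= X in the middle range, so the tail
    bounds apply to each factor. *)
Lemma conv_mid_le f g w (C X A x : R) :
  halfline_density f -> halfline_density g -> halfline_density w ->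
  (0 <= C)%R ->
  (forall y, (X < y)%R -> f y <= C%:E * w y) ->
  (forall y, (X < y)%R -> g y <= C%:E * w y) ->
  (X <= A)%R -> conv_mid f g A x <= (C * C)%:E * conv_mid w w A x.
Proof.
move=> [[mf f0 _] _] [[mg g0 _] _] [[mw w0 _] _] C0 fw gw XA.
have mww : measurable_fun `]A, (x - A)%R[ (fun y => w (x - y)%R * w y).
  exact: measurable_convolution_integrand.
rewrite /conv_mid -ge0_integralZl//; last 2 first.
- by move=> y _; rewrite mule_ge0.
- by rewrite lee_fin mulr_ge0.
apply: ge0_le_integral => //.
- by move=> y _; rewrite mule_ge0.
- exact: measurable_convolution_integrand.
- exact: measurable_funeM.
- move=> y; rewrite /= in_itv/= => /andP[Ay yA]; rewrite EFinM muleACA.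
  by apply: lee_pmul => //; [apply: fw|apply: gw]; lra.
Qed.

(** Out of w * w ~ 2w, each of the two heads already takes almost w. *)
Lemma subexponential_conv_mid w (e : R) : halfline_density w -> subexponential w ->
  (0 < e)%R -> exists2 A0 : R, (0 < A0)%R & forall A, (A0 <= A)%R ->
    \forall x \near +oo%R, conv_mid w w A x <= e%:E * w x.
Proof.
move=> dw [_ lw ww] e0; have [[mw w0 _] _] := dw.
have [[_ cw0 _] _] := convolution_halfline dw dw.
have w20 x : 0 <= 2%:E * w x by rewrite mule_ge0// lee_fin.
have {}ww := ((asymp_equivP cw0 w20).1 ww).2.
have e4 : (0 < e / 4)%R by rewrite divr_gt0.
have [wpos _] := long_tailedP lw.
have [A0 A00 heads] := conv_head_bounds lw dw e4.
exists A0 => // A A0A.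
have A_gt0 : (0 < A)%R by exact: lt_le_trans A0A.
have {}heads := heads A A0A; have {}ww := ww _ e4.
near=> x.
have /andP[wx0 wxy] : 0 < w x < +oo by near: x.
have wfin : w x \is a fin_num by rewrite ge0_fin_numE.
have /andP[hl _] : (1 - e / 4)%:E * w x <= conv_head w w A x <= (1 + e / 4)%:E * w x.
  by near: x.
have /andP[_ cu] : (1 - e / 4)%:E * (2%:E * w x) <= convolution w w x <=
    (1 + e / 4)%:E * (2%:E * w x) by near: x.
have xA : (2 * A < x)%R by near: x; apply: nbhs_pinfty_gt; exact: num_real.
move: cu; rewrite (convolution_split dw dw A_gt0 xA) => cu.
have m0 := conv_mid_ge0 A x dw dw.
have : (1 - e / 4)%:E * w x + conv_mid w w A x + (1 - e / 4)%:E * w x <=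
    (1 + e / 4)%:E * (2%:E * w x).
  by apply: le_trans cu; rewrite leeD// leeD.
rewrite -(fineK wfin) -!EFinM; move: m0; case: (conv_mid w w A x) => [m| |]//.
by move=> _; rewrite -!EFinD !lee_fin; lra.
Unshelve. all: by end_near. Qed.

(** The two heads alone account for this, the middle part being non-negative. *)
Lemma convolution_ge f g (e : R) : halfline_density f -> halfline_density g ->
  long_tailed f -> long_tailed g -> (0 < e)%R ->
  \forall x \near +oo%R, (1 - e)%:E * (f x + g x) <= convolution f g x.
Proof.
move=> df dg lf lg e0; have [[mf f0 _] _] := df; have [[mg g0 _] _] := dg.
have [A1 A10 h1] := conv_head_bounds lf dg e0.
have [A2 A20 h2] := conv_head_bounds lg df e0.
pose A := Num.max A1 A2.
have {}h1 : \forall x \near +oo%R, _ := h1 A ltac:(by rewrite le_max lexx).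
have {}h2 : \forall x \near +oo%R, _ := h2 A ltac:(by rewrite le_max lexx orbT).
have A_gt0 : (0 < A)%R by rewrite lt_max A10.
near=> x.
have xA : (2 * A < x)%R by near: x; apply: nbhs_pinfty_gt; exact: num_real.
have /andP[l1 _] : (1 - e)%:E * f x <= conv_head f g A x <= (1 + e)%:E * f x.
  by near: x.
have /andP[l2 _] : (1 - e)%:E * g x <= conv_head g f A x <= (1 + e)%:E * g x.
  by near: x.
rewrite (convolution_split df dg A_gt0 xA) muleDr ?ge0_adde_def ?inE//.
by rewrite leeD// -[X in X <= _]adde0 leeD// conv_mid_ge0.
Unshelve. all: by end_near. Qed.

(** f = O(w) at +oo. *)
Definition tail_dominated f w := exists2 C : R, (0 < C)%R &
  \forall x \near +oo%R, f x <= C%:E * w x.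

(** The heads give f + g.  The middle part is O(mid(w, w)) by domination, hence
    negligible with respect to w. *)
Lemma convolution_le f g w (e : R) : halfline_density f -> halfline_density g ->
  long_tailed f -> long_tailed g -> halfline_density w -> subexponential w ->
  tail_dominated f w -> tail_dominated g w -> (0 < e)%R ->
  \forall x \near +oo%R,
    convolution f g x <= (1 + e)%:E * (f x + g x) + e%:E * w x.
Proof.
move=> df dg lf lg dw sw [C1 C10 [X1 [_ fw]]] [C2 C20 [X2 [_ gw]]] e0.
have [[mf f0 _] _] := df; have [[mg g0 _] _] := dg; have [[mw w0 _] _] := dw.
have [A1 A10 h1] := conv_head_bounds lf dg e0.
have [A2 A20 h2] := conv_head_bounds lg df e0.
pose C := Num.max C1 C2.
have C0 : (0 < C)%R by rewrite lt_max C10.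
pose X := Num.max X1 X2.
have {}fw y : (X < y)%R -> f y <= C%:E * w y.
  rewrite gt_max => /andP[Xy _]; apply: (le_trans (fw _ Xy)).
  by rewrite lee_wpmul2r// lee_fin le_max lexx.
have {}gw y : (X < y)%R -> g y <= C%:E * w y.
  rewrite gt_max => /andP[_ Xy]; apply: (le_trans (gw _ Xy)).
  by rewrite lee_wpmul2r// lee_fin le_max lexx orbT.
have eC : (0 < e / (C * C))%R by rewrite divr_gt0// mulr_gt0.
have [A3 A30 m3] := subexponential_conv_mid dw sw eC.
pose A := Num.max X (Num.max A1 (Num.max A2 A3)).
have {}h1 : \forall x \near +oo%R, _ := h1 A ltac:(by rewrite !le_max lexx !orbT).
have {}h2 : \forall x \near +oo%R, _ := h2 A ltac:(by rewrite !le_max lexx !orbT).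
have {}m3 : \forall x \near +oo%R, _ := m3 A ltac:(by rewrite !le_max lexx !orbT).
have A_gt0 : (0 < A)%R by rewrite !lt_max A10 orbT.
near=> x.
have xA : (2 * A < x)%R by near: x; apply: nbhs_pinfty_gt; exact: num_real.
have /andP[_ l1] : (1 - e)%:E * f x <= conv_head f g A x <= (1 + e)%:E * f x.
  by near: x.
have /andP[_ l2] : (1 - e)%:E * g x <= conv_head g f A x <= (1 + e)%:E * g x.
  by near: x.
have m : conv_mid w w A x <= (e / (C * C))%:E * w x by near: x.
rewrite (convolution_split df dg A_gt0 xA) muleDr ?ge0_adde_def ?inE//.
rewrite addeAC leeD//; first by rewrite leeD.
apply: (le_trans (conv_mid_le x df dg dw (ltW C0) fw gw _)).
  by rewrite le_max lexx.
apply: (@le_trans _ _ ((C * C)%:E * ((e / (C * C))%:E * w x))).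
  by rewrite lee_wpmul2l// lee_fin mulr_ge0// ltW.
by rewrite muleA -EFinM mulrCA divff ?mulr1// mulf_neq0// gt_eqF.
Unshelve. all: by end_near. Qed.

End tail_estimates.

(** * Closure properties of long-tailed and subexponential densities *)

Section closure_properties.
Local Open Scope classical_set_scope.
Local Open Scope ereal_scope.
Context {R : realType}.
Implicit Types (f g w a b : R -> \bar R) (p q e : R).

Lemma long_tailed_of_bounds f : measurable_fun [set: R] f -> (forall x, 0 <= f x) ->
  (\forall x \near +oo%R, 0 < f x < +oo) ->
  (forall y e : R, (0 < e)%R -> \forall x \near +oo%R,
     (1 - e)%:E * f x <= f (x - y)%R <= (1 + e)%:E * f x) ->
  long_tailed f.
Proof.
move=> mf f0 fpos fs; split=> // y.
by apply/(asymp_equivP (fun x => f0 (x - y)%R) f0); split=> // e; exact: fs.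
Qed.

Lemma near_shift (y : R) (P : R -> Prop) :
  (\forall x \near +oo%R, P x) -> \forall x \near +oo%R, P (x - y)%R.
Proof.
move=> [M [_ MP]]; near=> x; apply: MP.
by rewrite ltrBrDr; near: x; apply: nbhs_pinfty_gt; exact: num_real.
Unshelve. all: by end_near. Qed.

(** Write a(x - y) / a(x) as the product of a(x - y) / b(x - y), b(x - y) / b(x) and
    b(x) / a(x), each of which is close to 1. *)
Lemma long_tailed_asymp_equiv a b : measurable_fun [set: R] a -> (forall x, 0 <= a x) ->
  asymp_equiv a b -> long_tailed b -> long_tailed a.
Proof.
move=> ma a0 ab lb; have [_ b0 _] := lb.
have [bpos bs] := long_tailedP lb.
have {}ab := ((asymp_equivP a0 b0).1 ab).2.
apply: long_tailed_of_bounds => //.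
  have h : (0 < (2^-1 : R))%R by lra.
  have {}ab := ab _ h.
  near=> x; have /andP[bx0 bxy] : 0 < b x < +oo by near: x.
  have : (1 - 2^-1)%:E * b x <= a x <= (1 + 2^-1)%:E * b x by near: x.
  have bfin : b x \is a fin_num by rewrite ge0_fin_numE// ltW.
  move: bx0; rewrite -(fineK bfin) -!EFinM lte_fin => bx0 /andP[l u].
  rewrite (le_lt_trans u) ?ltry// andbT (lt_le_trans _ l)// lte_fin; nra.
move=> y e e0.
(* Small enough that (1 + d)^2 / (1 - d) <= 1 + e and
   (1 - d)^2 / (1 + d) >= 1 - e. *)
pose d := (Num.min e 1 / 8)%R.
have [d0 d1 de] : [/\ (0 < d)%R, (8 * d <= 1)%R & (8 * d <= e)%R].
  have -> : (8 * d = Num.min e 1)%R by rewrite /d; field.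
  by rewrite !ge_min !lexx orbT; split=> //; rewrite divr_gt0// lt_min e0 ltr01.
have {}ab := ab _ d0; have aby := near_shift y ab.
have {}bs := bs y _ d0.
near=> x; have /andP[bx0 bxy] : 0 < b x < +oo by near: x.
have bfin : b x \is a fin_num by rewrite ge0_fin_numE// ltW.
have /andP[l1 u1] : (1 - d)%:E * b x <= a x <= (1 + d)%:E * b x by near: x.
have /andP[l2 u2] : (1 - d)%:E * b (x - y)%R <= a (x - y)%R <=
    (1 + d)%:E * b (x - y)%R by near: x.
have /andP[l3 u3] : (1 - d)%:E * b x <= b (x - y)%R <= (1 + d)%:E * b x by near: x.
move: bx0 l1 u1 l2 u2 l3 u3 (a0 x) (a0 (x - y)%R) (b0 (x - y)%R).
rewrite -(fineK bfin); move: (fine (b x)) => B.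
case: (b (x - y)%R) => [B'| |]; rewrite -?EFinM ?leye_eq//.
case: (a x) => [r| |]; rewrite -?EFinM ?leye_eq//.
case: (a (x - y)%R) => [s| |]; rewrite -?EFinM ?leye_eq//.
rewrite lte_fin !lee_fin => B0 l1 u1 l2 u2 l3 u3 _ _ _.
have s1 : (s <= (1 + d) * ((1 + d) * B))%R.
  by apply: le_trans u2 _; rewrite ler_wpM2l//; lra.
have s2 : ((1 - d) * ((1 - d) * B) <= s)%R.
  by apply: le_trans l2; rewrite ler_wpM2l//; lra.
have eB : (8 * d * ((1 - d) * B) <= e * r)%R.
  by apply: ler_pM => //; nra.
have c1 : ((1 + d) * ((1 + d) * B) <= (1 + 8 * d) * ((1 - d) * B))%R by nra.
have c2 : ((1 - 8 * d) * ((1 + d) * B) <= (1 - d) * ((1 - d) * B))%R by nra.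
have eB' : (8 * d * r <= e * r)%R by rewrite ler_wpM2r//; nra.
apply/andP; split; nra.
Unshelve. all: by end_near. Qed.

Lemma long_tailed_mixture p q f g : (0 < p)%R -> (0 < q)%R ->
  long_tailed f -> long_tailed g -> long_tailed (fun x => p%:E * f x + q%:E * g x).
Proof.
move=> p0 q0 lf lg; have [mf f0 _] := lf; have [mg g0 _] := lg.
have [fpos fs] := long_tailedP lf; have [gpos gs] := long_tailedP lg.
have pf0 x : 0 <= p%:E * f x by rewrite mule_ge0// lee_fin ltW.
have qg0 x : 0 <= q%:E * g x by rewrite mule_ge0// lee_fin ltW.
apply: long_tailed_of_bounds.
- by apply: emeasurable_funD; exact: measurable_funeM.
- by move=> x; rewrite adde_ge0.
- near=> x; have /andP[fx0 fxy] : 0 < f x < +oo by near: x.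
  have /andP[gx0 gxy] : 0 < g x < +oo by near: x.
  by rewrite adde_gt0 ?mule_gt0 ?lte_fin// lte_add_pinfty// lte_mul_pinfty// lee_fin ltW.
- move=> y e e0; have {}fs := fs y _ e0; have {}gs := gs y _ e0.
  near=> x; have /andP[l1 u1] : (1 - e)%:E * f x <= f (x - y)%R <= (1 + e)%:E * f x.
    by near: x.
  have /andP[l2 u2] : (1 - e)%:E * g x <= g (x - y)%R <= (1 + e)%:E * g x by near: x.
  rewrite !muleDr ?ge0_adde_def ?inE// !(muleCA _ p%:E) !(muleCA _ q%:E).
  by apply/andP; split; apply: leeD; rewrite lee_wpmul2l// lee_fin ltW.
Unshelve. all: by end_near. Qed.

Lemma halfline_density_mixture p q f g : (0 <= p)%R -> (0 <= q)%R -> (p + q = 1)%R ->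
  halfline_density f -> halfline_density g ->
  halfline_density (fun x => p%:E * f x + q%:E * g x).
Proof.
move=> p0 q0 pq [[mf f0 f1] fN] [[mg g0 g1] gN].
have pf0 x : 0 <= p%:E * f x by rewrite mule_ge0.
have qg0 x : 0 <= q%:E * g x by rewrite mule_ge0.
split; last by move=> x x0; rewrite fN// gN// !mule0 adde0.
split.
- by apply: emeasurable_funD; exact: measurable_funeM.
- by move=> x; rewrite adde_ge0.
- rewrite ge0_integralD//; last 2 first.
  + exact: measurable_funeM.
  + exact: measurable_funeM.
  by rewrite !ge0_integralZl// f1 g1 !mule1 -EFinD pq.
Qed.

Lemma asymp_equiv_tail_dominated a b : (forall x, 0 <= a x) -> (forall x, 0 <= b x) ->
  asymp_equiv a b -> tail_dominated a b /\ tail_dominated b a.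
Proof.
move=> a0 b0 /(asymp_equivP a0 b0)[_ ab].
have h : (0 < (2^-1 : R))%R by lra.
have {}ab := ab _ h.
split; [exists (1 + 2^-1)%R|exists 2%R]; rewrite ?addr_gt0//; near=> x;
  have /andP[l u] : (1 - 2^-1)%:E * b x <= a x <= (1 + 2^-1)%:E * b x by near: x.
  by [].
rewrite -lee_pdivrMl//; apply: le_trans l; rewrite lee_wpmul2r// lee_fin; lra.
Unshelve. all: by end_near. Qed.

Lemma tail_dominated_trans a b w :
  tail_dominated a b -> tail_dominated b w -> tail_dominated a w.
Proof.
move=> [C C0 ab] [D D0 bw]; exists (C * D)%R; first exact: mulr_gt0.
near=> x; have h1 : a x <= C%:E * b x by near: x.
have h2 : b x <= D%:E * w x by near: x.
by rewrite EFinM -muleA (le_trans h1)// lee_wpmul2l// lee_fin ltW.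
Unshelve. all: by end_near. Qed.

(** As w = O(f + g), the error term e w of the upper bound is of the form
    e' (f + g). *)
Lemma convolution_equiv_add f g w : halfline_density f -> halfline_density g ->
  long_tailed f -> long_tailed g -> halfline_density w -> subexponential w ->
  tail_dominated f w -> tail_dominated g w -> tail_dominated w (fun x => f x + g x) ->
  asymp_equiv (convolution f g) (fun x => f x + g x).
Proof.
move=> df dg lf lg dw sw fw gw [C C0 wfg].
have [[_ f0 _] _] := df; have [[_ g0 _] _] := dg; have [[_ w0 _] _] := dw.
have [[_ c0 _] _] := convolution_halfline df dg.
have [fpos _] := long_tailedP lf; have [gpos _] := long_tailedP lg.
apply/asymp_equivP => // [x|]; first exact: adde_ge0.
split.
  near=> x; have /andP[fx0 fxy] : 0 < f x < +oo by near: x.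
  have /andP[gx0 gxy] : 0 < g x < +oo by near: x.
  by rewrite adde_gt0// lte_add_pinfty.
move=> e e0; have d0 : (0 < e / (1 + C))%R by rewrite divr_gt0// addr_gt0.
have ge := convolution_ge df dg lf lg e0.
have le := convolution_le df dg lf lg dw sw fw gw d0.
near=> x; apply/andP; split; first by near: x.
have s0 : 0 <= f x + g x by exact: adde_ge0.
have wx : w x <= C%:E * (f x + g x) by near: x.
apply: (@le_trans _ _ ((1 + e / (1 + C))%:E * (f x + g x) + (e / (1 + C))%:E * w x)).
  by near: x.
apply: (@le_trans _ _ ((1 + e / (1 + C))%:E * (f x + g x) +
    (e / (1 + C))%:E * (C%:E * (f x + g x)))).
  by rewrite leeD2l// lee_wpmul2l// lee_fin ltW.
rewrite muleA -EFinM -ge0_muleDl; last 2 first.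
- by rewrite lee_fin addr_ge0// ltW.
- by rewrite lee_fin mulr_ge0// ltW.
have dE : (e / (1 + C) * (1 + C) = e)%R by rewrite mulfVK// gt_eqF// addr_gt0.
rewrite -EFinD lee_wpmul2r// lee_fin; move: dE; set d := (e / (1 + C))%R; lra.
Unshelve. all: by end_near. Qed.

Lemma adde_self (u : \bar R) : u + u = 2%:E * u.
Proof. by rewrite -[u in LHS]mul1e -ge0_muleDl. Qed.

(** The case f = g of the previous asymptotics: membership in the subexponential
    class depends only on the order of magnitude of a long-tailed density. *)
Lemma subexponential_tail_equiv f w : halfline_density f -> long_tailed f ->
  halfline_density w -> subexponential w ->
  tail_dominated f w -> tail_dominated w f -> subexponential f.
Proof.
move=> df lf dw sw fw wf; have [[_ f0 _] _] := df.
split=> //; first by case: df.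
rewrite (_ : (fun x => 2%:E * f x) = (fun x => f x + f x)).
  apply: (convolution_equiv_add df df lf lf dw sw fw fw).
  apply: tail_dominated_trans wf _; exists 1%R => //; near=> x.
  by rewrite mul1e -[leLHS]adde0 leeD2l.
by apply/funext => x; rewrite adde_self.
Unshelve. all: by end_near. Qed.

Lemma tail_dominated_mixturel p q f g : (0 < p)%R -> (0 <= q)%R ->
  (forall x, 0 <= g x) -> tail_dominated f (fun x => p%:E * f x + q%:E * g x).
Proof.
move=> p0 q0 g0; exists p^-1%R; rewrite ?invr_gt0//; near=> x.
by rewrite lee_pdivlMl// -[leLHS]adde0 leeD2l// mule_ge0.
Unshelve. all: by end_near. Qed.

Lemma tail_dominated_mixturer p q f g : (0 <= p)%R -> (0 < q)%R ->
  (forall x, 0 <= f x) -> tail_dominated g (fun x => p%:E * f x + q%:E * g x).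
Proof.
move=> p0 q0 f0; exists q^-1%R; rewrite ?invr_gt0//; near=> x.
by rewrite lee_pdivlMl// -[leLHS]add0e leeD2r// mule_ge0.
Unshelve. all: by end_near. Qed.

Lemma tail_dominated_mixture p q f g : (0 < p)%R -> (0 < q)%R ->
  (forall x, 0 <= f x) -> (forall x, 0 <= g x) ->
  tail_dominated (fun x => p%:E * f x + q%:E * g x) (fun x => f x + g x).
Proof.
move=> p0 q0 f0 g0; exists (p + q)%R; first exact: addr_gt0.
near=> x; rewrite ge0_muleDr//.
by apply: leeD; rewrite lee_wpmul2r// lee_fin ?lerDl ?lerDr ltW.
Unshelve. all: by end_near. Qed.

Lemma add_tail_dominated f g w : (forall x, 0 <= w x) ->
  tail_dominated f w -> tail_dominated g w -> tail_dominated (fun x => f x + g x) w.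
Proof.
move=> w0 [C C0 fw] [D D0 gw]; exists (C + D)%R; first exact: addr_gt0.
near=> x; rewrite EFinD ge0_muleDl ?lee_fin ?(ltW C0) ?(ltW D0)//.
apply: leeD; by near: x.
Unshelve. all: by end_near. Qed.

(** * Convolution and mixture of two densities *)

Section two_densities.
Variables f g : R -> \bar R.
Hypotheses (df : halfline_density f) (dg : halfline_density g).

Let f0 : forall x, 0 <= f x. Proof. by case: df => -[]. Qed.
Let g0 : forall x, 0 <= g x. Proof. by case: dg => -[]. Qed.
Let dc : halfline_density (convolution f g). Proof. exact: convolution_halfline. Qed.
Let c0 : forall x, 0 <= convolution f g x. Proof. by case: dc => -[]. Qed.
Let add0 : forall x, 0 <= f x + g x. Proof. by move=> x; exact: adde_ge0. Qed.

(** Here f * g itself is the dominating subexponential density: f and g are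
    O(f * g) by the general lower bound, and the resulting upper bound
    f * g <= (1 + e)(f + g) + e (f * g) shows that f * g = O(f + g). *)
Lemma convolution_equiv_of_subexponential : long_tailed f -> long_tailed g ->
  subexponential (convolution f g) ->
  asymp_equiv (convolution f g) (fun x => f x + g x).
Proof.
move=> lf lg sc.
have h : (0 < (2^-1 : R))%R by lra.
have low := convolution_ge df dg lf lg h.
have fgc : tail_dominated (fun x => f x + g x) (convolution f g).
  exists 2%R => //; near=> x.
  rewrite -lee_pdivrMl//.
  have -> : (2^-1)%:E = (1 - 2^-1)%:E :> \bar R by congr EFin; field.
  by near: x.
have [fc gc] : tail_dominated f (convolution f g) /\ tail_dominated g (convolution f g).
  split; apply: tail_dominated_trans fgc; exists 1%R => //; near=> x; rewrite mul1e.
    by rewrite -[leLHS]adde0 leeD2l.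
  by rewrite -[leLHS]add0e leeD2r.
have h4 : (0 < (4^-1 : R))%R by lra.
have [_ /long_tailedP[cpos _] _] := sc.
have up := convolution_le df dg lf lg dc sc fc gc h4.
apply: (convolution_equiv_add df dg lf lg dc sc fc gc).
exists 2%R => //; near=> x.
have /andP[cx0 cxy] : 0 < convolution f g x < +oo by near: x.
have : convolution f g x <= (1 + 4^-1)%:E * (f x + g x) + 4^-1%:E * convolution f g x.
  by near: x.
have cfin : convolution f g x \is a fin_num by rewrite ge0_fin_numE// ltW.
rewrite -(fineK cfin); move: (add0 x); case: (f x + g x) => [s| |]//.
  by rewrite -!EFinM -EFinD !lee_fin; lra.
by move=> _ _; rewrite gt0_muley ?lte_fin// leey.
Unshelve. all: by end_near. Qed.

(** The half mixture has the order of f + g, hence of w. *)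
Lemma subexponential_half_mixture (w : R -> \bar R) : long_tailed f -> long_tailed g ->
  halfline_density w -> subexponential w -> asymp_equiv w (fun x => f x + g x) ->
  subexponential (fun x => (2^-1)%:E * f x + (2^-1)%:E * g x).
Proof.
move=> lf lg dw sw wfg; have [[_ w0 _] _] := dw.
have h : (0 < (2^-1 : R))%R by lra.
have h0 := ltW h.
have [wd dw'] := asymp_equiv_tail_dominated w0 add0 wfg.
have dm : halfline_density (fun x => (2^-1)%:E * f x + (2^-1)%:E * g x).
  by apply: halfline_density_mixture => //; field.
have [[_ m0 _] _] := dm.
apply: (subexponential_tail_equiv dm _ dw sw).
- exact: long_tailed_mixture.
- by apply: tail_dominated_trans dw'; exact: tail_dominated_mixture.
- apply: tail_dominated_trans wd _.
  by apply: add_tail_dominated => //;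
    [exact: tail_dominated_mixturel|exact: tail_dominated_mixturer].
Qed.

(** The mixture and f + g dominate each other, so f * g ~ f + g; this makes
    f * g long-tailed and of the order of the mixture. *)
Lemma subexponential_convolution_of_mixture p q : (0 < p)%R -> (0 < q)%R ->
  (p + q = 1)%R -> long_tailed f -> long_tailed g ->
  subexponential (fun x => p%:E * f x + q%:E * g x) ->
  subexponential (convolution f g).
Proof.
move=> p0 q0 pq lf lg sm.
have dm := halfline_density_mixture (ltW p0) (ltW q0) pq df dg.
have [[_ m0 _] _] := dm.
have fm := tail_dominated_mixturel f p0 (ltW q0) g0.
have gm := tail_dominated_mixturer g (ltW p0) q0 f0.
have mfg := tail_dominated_mixture p0 q0 f0 g0.
have cfg := convolution_equiv_add df dg lf lg dm sm fm gm mfg.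
have [cd dc'] := asymp_equiv_tail_dominated c0 add0 cfg.
have lfg : long_tailed (fun x => f x + g x).
  have := long_tailed_mixture ltr01 ltr01 lf lg.
  by congr long_tailed; apply/funext => x; rewrite !mul1e.
have lc : long_tailed (convolution f g).
  by apply: long_tailed_asymp_equiv cfg lfg => //; case: dc => -[].
apply: (subexponential_tail_equiv dc lc dm sm).
- by apply: tail_dominated_trans cd _; exact: add_tail_dominated.
- exact: tail_dominated_trans mfg dc'.
Qed.

End two_densities.

Lemma convolutionC f g (x : R) : prob_density f -> prob_density g ->
  convolution f g x = convolution g f x.
Proof.
move=> [mf f0 _] [mg g0 _]; rewrite /convolution (ge0_integral_reflect x)//.
- by apply: eq_integral => y _; rewrite subKr muleC.
- exact: measurable_convolution_integrand.
- by move=> y; rewrite mule_ge0.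
Qed.

Lemma convolutionDr p q f g h (x : R) : (0 <= p)%R -> (0 <= q)%R ->
  prob_density f -> prob_density g -> prob_density h ->
  convolution h (fun y => p%:E * f y + q%:E * g y) x =
  p%:E * convolution h f x + q%:E * convolution h g x.
Proof.
move=> p0 q0 [mf f0 _] [mg g0 _] [mh h0 _].
rewrite /convolution -!ge0_integralZl//; last first.
all: try by [exact: measurable_convolution_integrand|move=> y _; rewrite mule_ge0].
rewrite -ge0_integralD//.
- by apply: eq_integral => y _; rewrite ge0_muleDr ?mule_ge0// !(muleCA (h _)).
- by move=> y _; rewrite !mule_ge0.
- by apply: measurable_funeM; exact: measurable_convolution_integrand.
- by move=> y _; rewrite !mule_ge0.
- by apply: measurable_funeM; exact: measurable_convolution_integrand.
Qed.

(** Expand the square of the half mixture m: the terms f * f, f * g and g * g are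
    equivalent to 2f, f + g and 2g, and 2f / 4 + (f + g) / 2 + 2g / 4 = 2m. *)
Lemma subexponential_half_mixture_of_equiv f g :
  halfline_density f -> halfline_density g ->
  subexponential f -> subexponential g ->
  asymp_equiv (convolution f g) (fun x => f x + g x) ->
  subexponential (fun x => (2^-1)%:E * f x + (2^-1)%:E * g x).
Proof.
move=> df dg sf sg cfg.
have [[mf lf ff] [mg lg gg]] := (sf, sg).
have [[_ f0 _] _] := df; have [[_ g0 _] _] := dg.
have [pff pfg pgg] : [/\ prob_density (convolution f f),
    prob_density (convolution f g) & prob_density (convolution g g)].
  by split; exact: convolution_prob_density.
have h : (0 < (2^-1 : R))%R by lra.
have h0 := ltW h.
have hh : (2^-1 + 2^-1 = 1 :> R)%R by field.
pose m x := (2^-1)%:E * f x + (2^-1)%:E * g x.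
have dm : halfline_density m by exact: halfline_density_mixture.
have [pm _] := dm; have [_ m0 _] := pm.
have pmm := convolution_prob_density pm pm.
have lm : long_tailed m by exact: long_tailed_mixture.
split=> //.
have mmE x : convolution m m x =
    2^-1%:E * (2^-1%:E * convolution f f x + 2^-1%:E * convolution f g x) +
    2^-1%:E * (2^-1%:E * convolution f g x + 2^-1%:E * convolution g g x).
  rewrite convolutionDr// (convolutionC x pm mf) (convolutionC x pm mg).
  by rewrite !convolutionDr// (convolutionC x mg mf).
have m20 x : 0 <= 2%:E * m x by rewrite mule_ge0.
have [fpos _] := long_tailedP lf; have [gpos _] := long_tailedP lg.
apply/asymp_equivP => //; first by case: pmm.
have [_ {}ff] := (asymp_equivP (prob_density_ge0 pff)
  (fun x => mule_ge0 (ltac:(by rewrite lee_fin) : 0 <= 2%:E) (f0 x))).1 ff.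
have [_ {}gg] := (asymp_equivP (prob_density_ge0 pgg)
  (fun x => mule_ge0 (ltac:(by rewrite lee_fin) : 0 <= 2%:E) (g0 x))).1 gg.
have [_ {}cfg] := (asymp_equivP (prob_density_ge0 pfg)
  (fun x => adde_ge0 (f0 x) (g0 x))).1 cfg.
have fgfin : \forall x \near +oo%R, exists F G : R,
    [/\ (0 < F)%R, (0 < G)%R, f x = F%:E & g x = G%:E].
  near=> x; have /andP[fx0 fxy] : 0 < f x < +oo by near: x.
  have /andP[gx0 gxy] : 0 < g x < +oo by near: x.
  have ffin : f x \is a fin_num by rewrite ge0_fin_numE.
  have gfin : g x \is a fin_num by rewrite ge0_fin_numE.
  by exists (fine (f x)), (fine (g x)); rewrite -!lte_fin !fineK.
split.
  near=> x; have [F [G [F0 G0 fE gE]]] : exists F G : R,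
    [/\ (0 < F)%R, (0 < G)%R, f x = F%:E & g x = G%:E] by near: x.
  by rewrite /m fE gE -!EFinM ltry andbT lte_fin; lra.
move=> e e0; have {}ff := ff _ e0; have {}gg := gg _ e0; have {}cfg := cfg _ e0.
near=> x; have [F [G [F0 G0 fE gE]]] : exists F G : R,
  [/\ (0 < F)%R, (0 < G)%R, f x = F%:E & g x = G%:E] by near: x.
have : (1 - e)%:E * (2%:E * f x) <= convolution f f x <= (1 + e)%:E * (2%:E * f x).
  by near: x.
have : (1 - e)%:E * (2%:E * g x) <= convolution g g x <= (1 + e)%:E * (2%:E * g x).
  by near: x.
have : (1 - e)%:E * (f x + g x) <= convolution f g x <= (1 + e)%:E * (f x + g x).
  by near: x.
rewrite mmE /m fE gE.
case: (convolution f g x) => [b| |]; rewrite -?EFinD -?EFinM ?leye_eq ?leeNy_eq ?andbF//.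
case: (convolution g g x) => [c| |]; rewrite -?EFinM ?leye_eq ?leeNy_eq ?andbF//.
case: (convolution f f x) => [a| |]; rewrite -?EFinM ?leye_eq ?leeNy_eq ?andbF//.
rewrite -?EFinD -?EFinM -?EFinD !lee_fin => /andP[? ?] /andP[? ?] /andP[? ?].
by apply/andP; split; lra.
Unshelve. all: by end_near. Qed.

End closure_properties.

Theorem lemma2p1 (R : realType) (f g : R -> R)
    (hf : density_on_Rplus f) (hg : density_on_Rplus g) :
  (long_tailed (EFin \o f) -> long_tailed (EFin \o g) ->
     (subexponential (convolution (EFin \o f) (EFin \o g)) <->
      exists p : R, [/\ 0 < p, p < 1 &
        subexponential (EFin \o (fun x => p * f x + (1 - p) * g x))]) /\
     (subexponential (convolution (EFin \o f) (EFin \o g)) ->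
      asymp_equiv (convolution (EFin \o f) (EFin \o g))
                  (EFin \o (fun x => f x + g x))))
  /\
  (subexponential (EFin \o f) -> subexponential (EFin \o g) ->
     (subexponential (convolution (EFin \o f) (EFin \o g)) <->
      asymp_equiv (convolution (EFin \o f) (EFin \o g))
                  (EFin \o (fun x => f x + g x)))).
Proof.
have halfline (h : R -> R) : density_on_Rplus h -> halfline_density (EFin \o h).
  by move=> [dh hN]; split=> // x x0; rewrite /= hN.
move/halfline: hf => df; move/halfline: hg => dg.
have dc := convolution_halfline df dg.
have sumE : EFin \o (fun x => f x + g x) =
    (fun x => (EFin \o f) x + (EFin \o g) x)%E by [].
have mixE p q : EFin \o (fun x => p * f x + q * g x) =
    (fun x => p%:E * (EFin \o f) x + q%:E * (EFin \o g) x)%E by [].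
have halfE : 1 - 2^-1 = 2^-1 :> R by field.
have equiv : long_tailed (EFin \o f) -> long_tailed (EFin \o g) ->
    subexponential (convolution (EFin \o f) (EFin \o g)) ->
    asymp_equiv (convolution (EFin \o f) (EFin \o g)) (EFin \o (fun x => f x + g x)).
  exact: (convolution_equiv_of_subexponential df dg).
split=> [lf lg|sf sg].
- split; last exact: equiv.
  split=> [sc|[p [p0 p1]]].
    exists 2^-1; split; [lra|lra|].
    rewrite halfE mixE.
    exact: (subexponential_half_mixture df dg lf lg dc sc (equiv lf lg sc)).
  rewrite mixE; have q0 : 0 < 1 - p by lra.
  have pq : p + (1 - p) = 1 by ring.
  exact: (subexponential_convolution_of_mixture df dg p0 q0 pq lf lg).
- have [_ lf _] := sf; have [_ lg _] := sg.
  split=> [|cfg]; first exact: equiv.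
  have h : 0 < (2^-1 : R) by lra.
  have hh : 2^-1 + 2^-1 = 1 :> R by field.
  apply: (subexponential_convolution_of_mixture df dg h h hh lf lg).
  exact: (subexponential_half_mixture_of_equiv df dg sf sg cfg).
Qed.
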